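(* Let $X$ be a real Hilbert space and let $A,B\colon X\rightrightarrows X$ be maximally monotone with $\operatorname{zer}(A+B)\neq\varnothing$. Suppose that $A$ is uniformly monotone. Set $T=\tfrac12(\mathrm{Id}+R_BR_A)$. Let $x_0\in X$ and set, for every $n\in\mathbb{N}$, $x_{n+1}=Tx_n$ and $y_n=J_Ax_n$. Then $\operatorname{zer}(A+B)$ is a singleton, $\operatorname{Fix}T\neq\varnothing$, and there exists $\overline{x}\in\operatorname{Fix}T$ such that the following hold: (i) $(y_n)_{n\in\mathbb{N}}$ converges strongly to $\overline{y}:=J_A\overline{x}$. (ii) Suppose that there exists $C\in\{A^{-1},B^{-1}\}$ such that $C$ is uniformly monotone. Then additionally: (a) $T$ is a contraction for large distances and $\operatorname{Fix}T=\{\overline{x}\}$. (b) $(x_n)_{n\in\mathbb{N}}$ converges strongly to $\overline{x}$.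
   Context: For $A\colon X\rightrightarrows X$, $\operatorname{gra}A=\{(x,x^* )\in X\times X : x^*\in Ax\}$, and $A^{-1}$ is the inverse operator, $x\in A^{-1}x^*\Leftrightarrow x^*\in Ax$. $\operatorname{zer}(A+B)=\{x\in X: 0\in Ax+Bx\}$; $\operatorname{Fix}T=\{x\in X: Tx=x\}$. The resolvent is $J_A=(\mathrm{Id}+A)^{-1}$ and the reflected resolvent is $R_A=2J_A-\mathrm{Id}$; for maximally monotone $A$ these are single-valued and defined on all of $X$. A modulus is an increasing (nondecreasing) function $\phi\colon[0,\infty)\to[0,+\infty]$ that vanishes only at $0$. An operator $A$ is uniformly monotone if there is a modulus $\phi$ such that $\langle x-y,x^*-y^*\rangle\ge\phi(\|x-y\|)$ for all $(x,x^* ),(y,y^* )\in\operatorname{gra}A$. $T\colon X\to X$ is a contraction for large distances if for each $\epsilon>0$ there exists $K_\epsilon<1$ such that $\|Tx-Ty\|\le K_\epsilon\|x-y\|$ whenever $\|x-y\|\ge\epsilon$. *)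

(* Defs.v *)
From HB Require Import structures.
From mathcomp Require Import all_boot all_order all_algebra.
From mathcomp Require Import all_classical all_reals all_analysis.

Set Implicit Arguments.
Unset Strict Implicit.
Unset Printing Implicit Defensive.

Import Order.TTheory GRing.Theory Num.Theory.
Import numFieldNormedType.Exports.

Local Open Scope classical_set_scope.
Local Open Scope ring_scope.

HB.mixin Record CompleteNormedModule_isHilbert (R : realType) X
    of CompleteNormedModule R X := {
  inner : {dot X for @idfun R} ;
  inner_normE : forall x : X, inner x x = `|x| ^+ 2
}.

#[short(type="hilbertType")]
HB.structure Definition Hilbert (R : realType) :=
  {X of CompleteNormedModule R X & CompleteNormedModule_isHilbert R X}.

Section Operators.
Context {R : realType} {X : hilbertType R}.
Implicit Types (A B : X -> set X) (T : X -> X).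

Definition gra A : set (X * X) := [set p | A p.1 p.2].

Definition op_id : X -> set X := fun x => [set x].

Definition op_add A B : X -> set X :=
  fun x => [set u + v | u in A x & v in B x].

Definition op_inv A : X -> set X := fun u => [set x | A x u].

Definition zer A : set X := [set x | A x 0].

Definition Fix T : set X := [set x | T x = x].

Definition monotone_op A := forall p q : X * X, gra A p -> gra A q ->
  0 <= inner (p.1 - q.1) (p.2 - q.2).

Definition maximally_monotone A := monotone_op A /\
  forall B, monotone_op B -> gra A `<=` gra B -> gra B = gra A.

(* [phi] stands for a function from [0, +oo[ to [0, +oo]; its values at
   negative reals are irrelevant. *)
Definition modulus (phi : R -> \bar R) :=
  [/\ (forall t, 0 <= t -> (0 <= phi t)%E),
      (forall s t, 0 <= s -> s <= t -> (phi s <= phi t)%E) &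
      (forall t, 0 <= t -> (phi t = 0%E <-> t = 0))].

Definition uniformly_monotone A := exists2 phi : R -> \bar R, modulus phi &
  forall p q : X * X, gra A p -> gra A q ->
    (phi `|p.1 - q.1|%R <= (inner (p.1 - q.1) (p.2 - q.2))%R%:E)%E.

Definition resolvent_op A : X -> set X := op_inv (op_add op_id A).

(* When [A] is maximally monotone, [resolvent_op A x] is a singleton for every
   [x] (Minty) and [resolvent A x] is its element; the default value 0 plays
   no role. *)
Definition resolvent A : X -> X := fun x => xget 0 (resolvent_op A x).

Definition reflected_resolvent A : X -> X := fun x => 2 *: resolvent A x - x.

Definition contraction_for_large_distances T := forall eps : R, 0 < eps ->
  exists2 K : R, K < 1 &
    forall x y : X, eps <= `|x - y| -> `|T x - T y| <= K * `|x - y|.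

End Operators.

(* Main.v *)
(* Write a = J_A x, s = x - a and b = J_B (a - s), t = a - s - b, so that s and t
   are values of A at a and of B at b, and T x = b + s.  With D denoting
   differences between two points x, y of X,
     |D T|^2 + |D a - D b|^2 + 2 <D a, D s> + 2 <D b, D t> = |D x|^2.
   Against a fixed point of T, the left-hand terms other than |D T|^2 therefore
   tend to 0 along the iteration, and uniform monotonicity of A gives (i).  If
   the inverse of A or of B is also uniformly monotone, then D x is the sum of
   vectors each controlled by these terms, so |D x|^2 - |D T|^2 is bounded below
   by a positive constant as soon as |D x| >= eps; cutting segments of X into
   pieces of length about eps makes T a contraction for large distances.

   That resolvents are defined everywhere (Minty) is obtained by minimizing the
   Fitzpatrick function plus the squared norm: by strong convexity minimizing
   sequences are Cauchy, and the minimizer yields a zero of Id + A. *)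

Require Import Defs.
From HB Require Import structures.
From mathcomp Require Import all_boot all_order all_algebra.
From mathcomp Require Import all_classical all_reals all_analysis.
From mathcomp Require Import ring lra.

Set Implicit Arguments.
Unset Strict Implicit.
Unset Printing Implicit Defensive.

Import Order.TTheory GRing.Theory Num.Theory.
Import numFieldNormedType.Exports.

Local Open Scope classical_set_scope.
Local Open Scope ring_scope.

(** * Algebra of the inner product *)

Section InnerProduct.
Context {R : realType} {X : hilbertType R}.
Implicit Types u v w : X.

Lemma innerC u v : inner u v = inner v u.
Proof. by rewrite hermC expr0 mul1r. Qed.

Definition innerDl u v w : inner (u + v) w = inner u w + inner v w :=
  linearDl _ _ _ _.

Definition innerNl u v : inner (- u) v = - inner u v := linearNl _ _ _.

Lemma innerZl a u v : inner (a *: u) v = a * inner u v.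
Proof. exact: linearZl_LR. Qed.

Lemma innerDr u v w : inner w (u + v) = inner w u + inner w v.
Proof. by rewrite innerC innerDl !(innerC w). Qed.

Lemma innerNr u v : inner u (- v) = - inner u v.
Proof. by rewrite innerC innerNl innerC. Qed.

Lemma innerZr a u v : inner u (a *: v) = a * inner u v.
Proof. by rewrite innerC innerZl innerC. Qed.

Definition innerE :=
  (innerDl, innerDr, innerNl, innerNr, innerZl, innerZr).

Lemma inner_ge0 u : 0 <= inner u u.
Proof. by rewrite inner_normE exprn_ge0. Qed.

End InnerProduct.

(** * Convergence from vanishing decrements; moduli *)

Section Sequences.
Context {R : realType}.

(** Being nonincreasing and bounded below, [u] converges, so its decrements eventually drop below
    any [d]. In the applications [u] is the squared distance to a fixed point. *)
Lemma cvg_decrements0 {V : normedModType R} (u : R^nat) (f : nat -> V) (l : V) :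
  (forall n, 0 <= u n) -> (forall n, u n.+1 <= u n) ->
  (forall eps, 0 < eps -> exists2 d : R, 0 < d &
     forall n, eps <= `|l - f n| -> d <= u n - u n.+1) ->
  f @ \oo --> l.
Proof.
move=> u0 uS H.
have cu : cvgn u.
  apply: nonincreasing_is_cvgn; first exact/nonincreasing_seqP.
  by exists 0 => _ [n _ <-].
have : (fun n => u n - u n.+1) @ \oo --> lim (u @ \oo) - lim (u @ \oo).
  by apply: cvgB => //; rewrite (cvg_shiftS u).
rewrite subrr => /cvgrPdist_lt du.
apply/cvgrPdist_lt => e /H[d d0 Hd].
apply: filterS (du _ d0) => n; rewrite sub0r normrN.
move=> lt_d; rewrite ltNge; apply/negP => /Hd.
by rewrite leNgt (le_lt_trans (ler_norm _) lt_d).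
Qed.

Lemma modulus_gap (phi : R -> \bar R) (eps : R) : modulus phi -> 0 < eps ->
  exists2 d : R, 0 < d &
    forall t r, eps <= t -> (phi t <= r%:E)%E -> d <= r.
Proof.
move=> [phi_ge0 phi_nd phi0] eps0.
have phi_pos : (0 < phi eps)%E.
  rewrite lt0e phi_ge0 ?ltW// andbT; apply/eqP => /phi0.
  by move/(_ (ltW eps0)) => eps_eq0; rewrite eps_eq0 ltxx in eps0.
case E: (phi eps) phi_pos => [d| |] // d0.
- exists d => // t r et tr; rewrite -lee_fin -E.
  exact: le_trans (phi_nd _ _ (ltW eps0) et) tr.
(* Here [phi eps] is +oo, which no real [r] bounds: any positive [d] would do. *)
- exists 1 => // t r et /(le_trans (phi_nd _ _ (ltW eps0) et)).
  by rewrite E leye_eq.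
Qed.

End Sequences.

(** * Maximal monotonicity, the Fitzpatrick function and Minty's theorem *)

Section Monotone.
Context {R : realType} {X : hilbertType R}.
Implicit Types (A : X -> set X) (T : X -> X).

Lemma monotone_opP A a s a' s' : monotone_op A -> A a s -> A a' s' ->
  0 <= inner (a - a') (s - s').
Proof. by move=> mA As As'; exact: (mA (a, s) (a', s')). Qed.

Lemma uniformly_monotone_gap A eps : uniformly_monotone A -> 0 < eps ->
  exists2 d, 0 < d & forall a s a' s', A a s -> A a' s' ->
    eps <= `|a - a'| -> d <= inner (a - a') (s - s').
Proof.
move=> [phi mphi umA] /(modulus_gap mphi)[d d0 Hd].
exists d => // a s a' s' As As'.
by move=> /Hd; apply; exact: (umA (a, s) (a', s')).
Qed.

(** Adjoining (x, u) to the graph keeps it monotone, so by maximality the pair is already there. *)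
Lemma maximally_monotone_mem A x u : maximally_monotone A ->
  (forall a b, A a b -> 0 <= inner (x - a) (u - b)) -> A x u.
Proof.
move=> [mA maxA] H.
pose B y : set X := A y `|` [set v | y = x /\ v = u].
have mB : monotone_op B.
  move=> [a s] [b t] /= [As|[/= -> ->]] [At|[/= -> ->]].
  - exact: (monotone_opP mA).
  - by rewrite -opprB -(opprB u) innerNl innerNr opprK; exact: H.
  - exact: H.
  - by rewrite !subrr inner_ge0.
have grB : gra B (x, u) by right.
by rewrite (maxA B mB) in grB => // -[a b] Ab; left.
Qed.

(* The supremum of [fitz p q a b] over the graph of [A] is
   [2 F(- q, - p) + `|p| ^+ 2 + `|q| ^+ 2], with [F] the Fitzpatrick function of
   [A].  It is written with squared norms only, so that the passage to the limit
   along a minimizing sequence just uses the continuity of the norm. *)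
Definition fitz (p q a b : X) : R :=
  `|a - p| ^+ 2 + `|b - q| ^+ 2 - `|a + b| ^+ 2.

Definition fitz_le A p q v := forall a b, A a b -> fitz p q a b <= v.

(** The inner product compares (a, b) with (- q, - p): its sign tells whether the two pairs are
    monotonically related. *)
Lemma fitzE p q a b : fitz p q a b =
  `|p + q| ^+ 2 - 2 * inner (q + a) (p + b).
Proof.
rewrite /fitz -!inner_normE !innerE (innerC q p) (innerC a p) (innerC b q).
by rewrite (innerC b a); ring.
Qed.

(** In (p, q), [fitz] is the squared norm plus an affine function, hence strong convexity with
    equality. *)
Lemma fitz_conv p q p' q' a b t :
  fitz ((1 - t) *: p + t *: p') ((1 - t) *: q + t *: q') a b =
  (1 - t) * fitz p q a b + t * fitz p' q' a b
  - t * (1 - t) * (`|p - p'| ^+ 2 + `|q - q'| ^+ 2).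
Proof.
rewrite /fitz -!inner_normE !innerE (innerC p' p) (innerC q' q) (innerC b a).
rewrite (innerC p a) (innerC p' a) (innerC q b) (innerC q' b).
by ring.
Qed.

Lemma fitz_conv_le A p q p' q' v v' t : 0 <= t <= 1 ->
  fitz_le A p q v -> fitz_le A p' q' v' ->
  fitz_le A ((1 - t) *: p + t *: p') ((1 - t) *: q + t *: q')
    ((1 - t) * v + t * v' - t * (1 - t) * (`|p - p'| ^+ 2 + `|q - q'| ^+ 2)).
Proof.
move=> /andP[t0 t1] H H' a b Ab; rewrite fitz_conv lerB// lerD//.
- by rewrite ler_wpM2l ?subr_ge0//; exact: H.
- by rewrite ler_wpM2l//; exact: H'.
Qed.

Lemma fitz_le_graph A a b : monotone_op A -> A a b ->
  fitz_le A (- b) (- a) (`|a + b| ^+ 2).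
Proof.
move=> mA Ab a' b' Ab'; rewrite fitzE -opprD normrN (addrC b a) gerBl.
by rewrite addrC (addrC _ b') mulr_ge0//; exact: (monotone_opP mA).
Qed.

(** The Fitzpatrick inequality F(x, u) >= <x, u> at (- q, - p). Off the graph, a smaller bound would
    make this pair monotonically related to the whole graph, hence a member of it. *)
Lemma fitz_le_ge A p q v : maximally_monotone A -> fitz_le A p q v ->
  `|p + q| ^+ 2 <= v.
Proof.
move=> maxA H; have [Aqp|nAqp] := pselect (A (- q) (- p)).
  by have := H _ _ Aqp; rewrite fitzE !subrr linear0r mulr0 subr0.
rewrite leNgt; apply/negP => ltv; apply: nAqp.
apply: maximally_monotone_mem => // a b Ab.
have := H _ _ Ab; rewrite fitzE -!opprD innerNl innerNr opprK.
by move: ltv; lra.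
Qed.

Lemma cvgn_sq_dist_le (f : nat -> X) :
  (forall n k, (n <= k)%N -> `|f n - f k| ^+ 2 <= 4 * n.+1%:R^-1) ->
  cvgn f.
Proof.
move=> H; apply/cauchy_cvgP/cauchy_exP => e e0.
have e80 : 0 < e ^+ 2 / 4 by rewrite divr_gt0 ?exprn_gt0.
have [N _ HN] := near_infty_natSinv_lt (PosNum e80).
exists (f N); exists N => // k /= Nk; rewrite -ball_normE/=.
rewrite -(@ltr_pXn2r _ 2)// ?nnegrE ?normr_ge0 ?ltW//.
apply: le_lt_trans (H _ _ Nk) _.
by have /= := HN N (leqnn N); rewrite ltr_pdivlMr// mulrC.
Qed.

Lemma fitz_minimizer A : maximally_monotone A -> exists p q m,
  fitz_le A p q m /\ forall p' q' v, fitz_le A p' q' v -> m <= v.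
Proof.
move=> maxA; pose V := [set v | exists p q, fitz_le A p q v].
have V0 : V !=set0.
  have [[[a b] Aab]|nA] := pselect (exists c : X * X, A c.1 c.2).
    exists (`|a + b| ^+ 2), (- b), (- a).
    by apply: fitz_le_graph => //; case: maxA.
  (* Over an empty graph every bound holds vacuously. *)
  by exists 0, 0, 0 => a b Ab; case: nA; exists (a, b).
have lbV : has_lbound V.
  exists 0 => v [p [q /(fitz_le_ge maxA)]].
  by apply: le_trans; exact: exprn_ge0.
have infV : has_inf V by [].
pose m := inf V.
have min_m p q v : fitz_le A p q v -> m <= v.
  by move=> H; apply: ge_inf => //; exists p, q.
have /choice[w Hw] : forall n : nat, exists w : X * X,
    fitz_le A w.1 w.2 (m + n.+1%:R^-1).
  move=> n; have [|v [p [q H]] ltv] := inf_adherent _ infV (eps := n.+1%:R^-1).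
    by rewrite invr_gt0.
  by exists (p, q) => a b Ab; exact: le_trans (H _ _ Ab) (ltW ltv).
have dist_w n k : (n <= k)%N ->
    `|(w n).1 - (w k).1| ^+ 2 + `|(w n).2 - (w k).2| ^+ 2 <= 4 * n.+1%:R^-1.
  move=> nk; have half01 : 0 <= (2^-1 : R) <= 1.
    by rewrite invr_ge0 ler0n/= invf_le1// ler1n.
  (* The midpoint has as bound the mean of the two bounds minus a quarter of the squared distance,
     and this is still at least [m]. *)
  have /min_m := fitz_conv_le half01 (Hw n) (Hw k).
  have : k.+1%:R^-1 <= n.+1%:R^-1 :> R by rewrite lef_pV2 ?posrE// ler_nat.
  move: (k.+1%:R^-1) (n.+1%:R^-1) (`|_ - _| ^+ 2) (`|_ - _| ^+ 2) => v u D1 D2.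
  by lra.
have cp : cvgn (fun n => (w n).1).
  apply: cvgn_sq_dist_le => n k nk; apply: le_trans (dist_w _ _ nk).
  by rewrite lerDl exprn_ge0.
have cq : cvgn (fun n => (w n).2).
  apply: cvgn_sq_dist_le => n k nk; apply: le_trans (dist_w _ _ nk).
  by rewrite lerDr exprn_ge0.
exists (lim ((fun n => (w n).1) @ \oo)), (lim ((fun n => (w n).2) @ \oo)), m.
split=> [a b Ab|]; last exact: min_m.
have cf : (fun n => fitz (w n).1 (w n).2 a b) @ \oo -->
    fitz (lim ((fun n => (w n).1) @ \oo)) (lim ((fun n => (w n).2) @ \oo)) a b.
  apply: cvgB; last exact: cvg_cst.
  by apply: cvgD; rewrite expr2; under eq_fun do rewrite expr2;
    apply: cvgM; apply: cvg_norm; apply: cvgB => //; exact: cvg_cst.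
have cm : (fun n => m + n.+1%:R^-1) @ \oo --> m + 0.
  by apply: cvgD; [exact: cvg_cst|exact: cvg_harmonic].
rewrite -[leRHS]addr0; apply: ler_cvg_to cf cm _.
by near=> n; exact: Hw.
Unshelve. all: by end_near. Qed.

Lemma minty0 A : maximally_monotone A -> exists a, A a (- a).
Proof.
move=> maxA; have [p [q [m [Hpq min_m]]]] := fitz_minimizer maxA.
have m_ge := fitz_le_ge maxA Hpq.
have opt a b : A a b -> `|p + q| ^+ 2 <= inner (p - a) (q - b).
  move=> Ab; set D := `|p + b| ^+ 2 + `|q + a| ^+ 2.
  (* Moving the minimizer a fraction [t] towards (- b, - a) cannot get below [m]; the resulting
     inequality is divided by [t], which then tends to 0. *)
  have step t : 0 < t <= 1 -> m <= `|a + b| ^+ 2 - (1 - t) * D.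
    move=> /andP[t0 t1]; have t01 : 0 <= t <= 1 by rewrite ltW.
    have := fitz_conv_le t01 Hpq (fitz_le_graph (proj1 maxA) Ab).
    move=> /min_m; rewrite !opprK -/D -subr_ge0.
    rewrite (_ : _ - m = t * (`|a + b| ^+ 2 - (1 - t) * D - m)); last by ring.
    by rewrite pmulr_rge0// subr_ge0.
  have D0 : 0 <= D by rewrite addr_ge0 ?exprn_ge0.
  have mD : m <= `|a + b| ^+ 2 - D.
    apply/ler_addgt0Pr => e e0.
    (* This denominator makes [t = e / (D + e + 1)] at most 1 and [t * D] at most [e]. *)
    have De : 0 < D + e + 1 by lra.
    have te : 0 < e / (D + e + 1) <= 1.
      by rewrite divr_gt0// ler_pdivrMr//; lra.
    apply: le_trans (step _ te) _.
    have : e / (D + e + 1) * D <= e.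
      by rewrite mulrAC ler_pdivrMr// ler_pM2l//; lra.
    by lra.
  move: m_ge mD; rewrite /D -!inner_normE !innerE (innerC b a) (innerC q p).
  by rewrite (innerC b p) (innerC a q) (innerC p q); lra.
have Apq : A p q.
  apply: maximally_monotone_mem => // a b /opt.
  by apply: le_trans; exact: exprn_ge0.
(* Testing [opt] at (p, q) itself forces q = - p. *)
have := opt _ _ Apq; rewrite !subrr linear0r => pq_le0.
exists p; have /eqP : p + q == 0.
  by rewrite -normr_eq0 -sqrf_eq0 eq_le pq_le0 exprn_ge0.
by rewrite addrC => /eqP; rewrite addr_eq0 => /eqP <-.
Qed.

(** Translating the values of [A] by [- x] preserves differences, hence monotonicity and maximality,
    and reduces the claim to [minty0]. *)
Lemma minty A x : maximally_monotone A -> exists a, A a (x - a).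
Proof.
move=> maxA; pose A' a : set X := [set b | A a (b + x)].
have sub_shift (b b' : X) : b + x - (b' + x) = b - b'.
  by rewrite opprD addrACA subrr addr0.
have mA' : monotone_op A'.
  move=> [a b] [a' b'] Ab Ab' /=; rewrite -(sub_shift b).
  exact: (monotone_opP (proj1 maxA) Ab Ab').
have [|a A'a] := @minty0 A'; last by exists a; rewrite addrC.
split=> // B mB AB; rewrite eqEsubset; split=> // -[a b] Bab.
apply: (maximally_monotone_mem maxA) => a' b' Ab'.
rewrite -[b' in b + x - b'](subrK x) sub_shift.
apply: (monotone_opP mB) => //; apply: (AB (a', b' - x)).
by rewrite /gra/A'/= subrK.
Qed.

(** If c + t = a + s with t in A c, monotonicity gives - |c - a|^2 >= 0, so [xget] can only pick
    [a]. *)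
Lemma resolventE A a s : monotone_op A -> A a s -> resolvent A (a + s) = a.
Proof.
move=> mA As; rewrite /resolvent; case: xgetP => [c _|]; last first.
  by move=> /(_ a); case; exists a => //; exists s.
move=> [_ -> [t At cE]].
have := monotone_opP mA At As.
rewrite (_ : t - s = - (c - a)); last first.
  rewrite opprB; apply/eqP; rewrite subr_eq addrAC -cE.
  by rewrite addrAC subrr add0r.
rewrite innerNr inner_normE oppr_ge0 => ca0.
by apply/eqP; rewrite -subr_eq0 -normr_eq0 -sqrf_eq0 eq_le ca0 exprn_ge0.
Qed.

Lemma resolventP A x : maximally_monotone A ->
  A (resolvent A x) (x - resolvent A x).
Proof.
move=> maxA; have [a Aa] := minty x maxA.
by have := resolventE (proj1 maxA) Aa; rewrite addrC subrK => ->.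
Qed.

End Monotone.

(** * From a loss in squared distance to a contraction *)

Section LargeDistances.
Context {R : realType} {X : hilbertType R} (T : X -> X).

(** The loss [d] is additive: taken alone, the contraction factor it yields tends to 1 as the
    distance grows. *)
Definition decreases_sq_dist := forall eps : R, 0 < eps ->
  exists2 d : R, 0 < d & forall x y,
    eps <= `|x - y| -> `|T x - T y| ^+ 2 + d <= `|x - y| ^+ 2.

(* Distances in [eps, 2 eps] are contracted by a constant factor, and a
   longer segment is a union of segments with lengths in this range. *)
Lemma decreases_sq_dist_contraction :
  decreases_sq_dist -> contraction_for_large_distances T.
Proof.
move=> sq_decrease eps eps0; have [d d0 Hd] := sq_decrease _ eps0.
(* With c = d / (8 eps^2), a distance r <= 2 eps satisfies r^2 - d <= (1 - 2 c) r^2 <= (1 - c)^2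
   r^2. *)
pose K := 1 - d / (8 * eps ^+ 2); exists K.
  by rewrite ltrBlDr ltrDl divr_gt0// mulr_gt0// exprn_gt0.
have eps20 : 0 < eps ^+ 2 by rewrite exprn_gt0.
have base x y : eps <= `|x - y| -> `|x - y| <= 2 * eps ->
    `|T x - T y| <= K * `|x - y|.
  move=> le1 le2; have := Hd _ _ le1.
  set r := `|x - y| in le1 le2 *; set t := `|_| => td.
  have t0 : 0 <= t by exact: normr_ge0.
  have r0 : 0 < r by exact: lt_le_trans le1.
  have r2 : r ^+ 2 <= 4 * eps ^+ 2.
    rewrite (_ : 4 * _ = (2 * eps) ^+ 2); last by ring.
    by rewrite ler_pXn2r// nnegrE; lra.
  have t20 : 0 <= t ^+ 2 by exact: exprn_ge0.
  pose c := d / (8 * eps ^+ 2).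
  have cE : c * (8 * eps ^+ 2) = d.
    by rewrite /c divfK// gt_eqF// mulr_gt0.
  have c0 : 0 < c by rewrite divr_gt0// mulr_gt0.
  (* Since [d <= r ^+ 2 <= 4 * eps ^+ 2]; this makes [K] nonnegative, so that squares can be
     compared. *)
  have c1 : c <= 2^-1.
    by rewrite /c ler_pdivrMr ?mulr_gt0//; lra.
  have K0 : 0 <= K by rewrite /K -/c; lra.
  rewrite -(@ler_pXn2r _ 2)// ?nnegrE ?mulr_ge0 ?(ltW r0)//.
  rewrite exprMn /K -/c.
  have : 2 * c * r ^+ 2 <= 2 * c * (4 * eps ^+ 2) 
    by rewrite ler_wpM2l// mulr_ge0// ltW.
  have : 0 <= c ^+ 2 * r ^+ 2 by rewrite mulr_ge0 ?exprn_ge0// ltW.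
  rewrite (_ : (1 - c) ^+ 2 * r ^+ 2 =
    r ^+ 2 - 2 * c * r ^+ 2 + c ^+ 2 * r ^+ 2); last by ring.
  by lra.
(* Counting starts at 2 because [base] covers lengths up to [2 * eps]. *)
suff H n x y : eps <= `|x - y| -> `|x - y| <= n.+2%:R * eps ->
    `|T x - T y| <= K * `|x - y|.
  move=> x y le1; apply: (H (Num.truncn (`|x - y| / eps))) => //.
  rewrite -ler_pdivrMr//; apply: ltW.
  by apply: lt_trans (truncnS_gt _) _; rewrite ltr_nat.
elim: n x y => [|n IHn] x y le1 le2; first exact: base.
have [le3|lt3] := leP `|x - y| (2 * eps); first exact: base.
have r0 : 0 < `|x - y| by exact: lt_le_trans le1.
(* [z] lies on the segment at distance [eps] from [x]; the rest is longer than [eps], and the two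
   lengths add up to [|x - y|]. *)
pose c := eps / `|x - y|; pose z := x - c *: (x - y).
have cE : c * `|x - y| = eps by rewrite divfK ?gt_eqF.
have c0 : 0 < c by rewrite divr_gt0.
have c1 : c <= 1 by rewrite ler_pdivrMr// mul1r.
have xzE : `|x - z| = eps by rewrite subKr normrZ gtr0_norm.
have zyE : `|z - y| = `|x - y| - eps.
  rewrite /z addrAC -{1}[x - y]scale1r -scalerBl normrZ ger0_norm ?subr_ge0//.
  by rewrite mulrBl mul1r cE.
rewrite -(subrKA (T z)); apply: le_trans (ler_normD _ _) _.
have le_xz : `|T x - T z| <= K * `|x - z| by apply: base; rewrite xzE//; lra.
have le_zy : `|T z - T y| <= K * `|z - y|.
  apply: IHn; rewrite zyE; first lra.
  by move: le2; rewrite -[n.+3]addn1 natrD mulrDl mul1r; lra.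
by move: le_xz le_zy; rewrite xzE zyE; lra.
Qed.

End LargeDistances.

(** * The Douglas-Rachford operator *)

Section DouglasRachford.
Context {R : realType} {X : hilbertType R}.

Lemma dr_identity (a s b t : X) : s + t = a - b ->
  `|b + s| ^+ 2 + `|a - b| ^+ 2 + 2 * inner a s + 2 * inner b t
  = `|a + s| ^+ 2.
Proof.
move=> stE; have -> : t = a - b - s by rewrite -stE addrC addKr.
rewrite -!inner_normE !innerE (innerC b a) (innerC s a) (innerC s b).
by ring.
Qed.

Context {A B : X -> set X} {T : X -> X}.
Context (maxA : maximally_monotone A) (maxB : maximally_monotone B).
Context (TE : forall z : X, T z =
  2^-1 *: (z + reflected_resolvent B (reflected_resolvent A z))).

Let a z := resolvent A z.
Let s z := z - a z.
Let b z := resolvent B (a z - s z).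
Let t z := a z - s z - b z.

Let reflE z : reflected_resolvent A z = a z - s z.
Proof. by rewrite /reflected_resolvent scaler_nat mulr2n opprB addrA. Qed.

Let TE' z : T z = b z + s z.
Proof.
rewrite TE reflE /reflected_resolvent -/(b z).
apply: (canLR (scalerK _)); first by rewrite pnatr_eq0.
rewrite scalerDr addrCA; congr (_ + _).
by rewrite scaler_nat mulr2n opprB addrCA addrC.
Qed.

Let As z : A (a z) (s z). Proof. exact: resolventP. Qed.

Let Bt z : B (b z) (t z). Proof. exact: resolventP. Qed.

Let stE z : s z + t z = a z - b z.
Proof. by rewrite /t addrA (addrC (s z)) subrK. Qed.

Let sub_stE x y : (s x - s y) + (t x - t y) = (a x - a y) - (b x - b y).
Proof. by rewrite addrACA -opprD !stE !opprD !opprK [LHS]addrACA. Qed.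

Let sub_asE x y : x - y = (a x - a y) + (s x - s y).
Proof. by rewrite addrACA -opprD /s !(addrC (a _)) !subrK. Qed.

Let dist_identity x y :
  `|T x - T y| ^+ 2 + `|(a x - a y) - (b x - b y)| ^+ 2
  + 2 * inner (a x - a y) (s x - s y) + 2 * inner (b x - b y) (t x - t y)
  = `|x - y| ^+ 2.
Proof.
rewrite [in RHS](sub_asE x y) -(dr_identity (sub_stE x y)) !TE'.
by rewrite opprD addrACA.
Qed.

Let inner_a_ge0 x y : 0 <= inner (a x - a y) (s x - s y).
Proof. exact: (monotone_opP (proj1 maxA)). Qed.

Let inner_b_ge0 x y : 0 <= inner (b x - b y) (t x - t y).
Proof. exact: (monotone_opP (proj1 maxB)). Qed.

Lemma dr_nonexpansive x y :
  `|T x - T y| ^+ 2 + 2 * inner (a x - a y) (s x - s y) <= `|x - y| ^+ 2.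
Proof.
rewrite -(dist_identity x y).
have := exprn_ge0 2 (normr_ge0 ((a x - a y) - (b x - b y))).
by have := inner_b_ge0 x y; lra.
Qed.

(** At z + u the resolvent of [A] is z with remainder u, and then J_B (z - u) = z because - u is in
    B z. Zeros of the sum thus yield fixed points. *)
Lemma dr_fixpoint z u : A z u -> B z (- u) ->
  T (z + u) = z + u /\ resolvent A (z + u) = z.
Proof.
move=> Azu Bzu; have az : a (z + u) = z by exact: resolventE (proj1 maxA) Azu.
split=> //; have sz : s (z + u) = u by rewrite /s az addrAC subrr add0r.
by rewrite TE' /b az sz (resolventE (proj1 maxB) Bzu).
Qed.

(** As D x = D a + D s, one summand has norm at least eps / 2, and either case bounds <D a, D s>
    below. *)
Lemma dr_decreases_sq_dist_invA : uniformly_monotone A ->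
  uniformly_monotone (op_inv A) -> decreases_sq_dist T.
Proof.
move=> umA umC eps eps0; have e20 : 0 < eps / 2 by rewrite divr_gt0.
have [d d0 Hd] := uniformly_monotone_gap umA e20.
have [c c0 Hc] := uniformly_monotone_gap umC e20.
exists (Num.min d c); first by rewrite lt_min d0.
move=> x y le_eps; apply: le_trans (dr_nonexpansive x y); rewrite lerD2l.
have cases : eps / 2 <= `|a x - a y| \/ eps / 2 <= `|s x - s y|.
  have [|lt_a] := leP (eps / 2) `|a x - a y|; [by left|right].
  have : `|x - y| <= `|a x - a y| + `|s x - s y|.
    by rewrite {1}(sub_asE x y); exact: ler_normD.
  by lra.
rewrite ge_min; have pa := inner_a_ge0 x y; case: cases => [/Hd|/Hc] H.
- by have := H _ _ (As x) (As y); lra.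
- by have := H _ _ (As x) (As y); rewrite innerC; lra.
Qed.

(** As D x = D a + (D a - D b) - D t, one of the three terms has norm at least eps / 3, and each
    controls one term of [dist_identity]. *)
Lemma dr_decreases_sq_dist_invB : uniformly_monotone A ->
  uniformly_monotone (op_inv B) -> decreases_sq_dist T.
Proof.
move=> umA umC eps eps0; have e30 : 0 < eps / 3 by rewrite divr_gt0.
have [d d0 Hd] := uniformly_monotone_gap umA e30.
have [c c0 Hc] := uniformly_monotone_gap umC e30.
exists (Num.min (Num.min d c) ((eps / 3) ^+ 2)).
  by rewrite !lt_min d0 c0 exprn_gt0.
move=> x y le_eps; rewrite -(dist_identity x y).
set D := _ - (b x - b y); set m := Num.min _ _.
have md : m <= d by rewrite /m !ge_min lexx.
have mc : m <= c by rewrite /m !ge_min lexx orbT.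
have me : m <= (eps / 3) ^+ 2 by rewrite /m ge_min lexx orbT.
have pa := inner_a_ge0 x y; have pb := inner_b_ge0 x y.
have pD : 0 <= `|D| ^+ 2 by exact: exprn_ge0.
have [/Hd H|lt_a] := leP (eps / 3) `|a x - a y|.
  by have := H _ _ (As x) (As y); lra.
have [/Hc H|lt_t] := leP (eps / 3) `|t x - t y|.
  by have := H _ _ (Bt x) (Bt y); rewrite innerC; lra.
have leD : eps / 3 <= `|D|.
  have : `|x - y| <= `|a x - a y| + (`|D| + `|t x - t y|).
    rewrite {1}(sub_asE x y) -[s x - s y](addrK (t x - t y)) sub_stE -/D.
    apply: le_trans (ler_normD _ _) _; rewrite lerD2l.
    exact: ler_normB.
  by lra.
have : (eps / 3) ^+ 2 <= `|D| ^+ 2 by rewrite ler_pXn2r ?nnegrE ?(ltW e30).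
by lra.
Qed.

End DouglasRachford.

(** * Uniqueness of the zero and strong convergence of the iterates *)

Theorem theorem8p6 (R : realType) (X : hilbertType R) (A B : X -> set X)
    (T : X -> X) (x0 : X) (x y : nat -> X)
    (maxA : maximally_monotone A) (maxB : maximally_monotone B)
    (zerAB : zer (op_add A B) !=set0)
    (umA : uniformly_monotone A)
    (TE : forall z : X, T z =
      2^-1 *: (z + reflected_resolvent B (reflected_resolvent A z)))
    (xE0 : x 0%N = x0)
    (xES : forall n : nat, x n.+1 = T (x n))
    (yE : forall n : nat, y n = resolvent A (x n)) :
  (exists z : X, zer (op_add A B) = [set z]) /\
  Fix T !=set0 /\
  exists xbar : X,
    Fix T xbar /\
    y @ \oo --> resolvent A xbar /\
    ((exists C : X -> set X,
        [set op_inv A; op_inv B] C /\ uniformly_monotone C) ->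
      (contraction_for_large_distances T /\ Fix T = [set xbar]) /\
      x @ \oo --> xbar).
Proof.
have zer_split z : zer (op_add A B) z -> exists2 u, A z u & B z (- u).
  move=> [u Au [v Bv /eqP]]; rewrite addrC addr_eq0 => /eqP vE.
  by exists u; rewrite -?vE.
have [z0 zer0] := zerAB.
have [u Azu Bzu] := zer_split _ zer0.
have [Tx ax] := dr_fixpoint maxA maxB TE Azu Bzu.
set xbar := z0 + u in Tx ax.
have dist_le n : `|x n.+1 - xbar| ^+ 2
    + 2 * inner (y n - z0) (x n - y n - u) <= `|x n - xbar| ^+ 2.
  have := dr_nonexpansive maxB TE (x n) xbar.
  by rewrite Tx ax xES yE (_ : xbar - z0 = u)// /xbar addrAC subrr add0r.
have inner_ge0 n : 0 <= inner (y n - z0) (x n - y n - u).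
  by apply: (monotone_opP (proj1 maxA)) => //; rewrite yE; exact: resolventP.
have dist_noninc n : `|x n.+1 - xbar| ^+ 2 <= `|x n - xbar| ^+ 2.
  by have := dist_le n; have := inner_ge0 n; lra.
split.
  exists z0; apply/seteqP; split=> [z /zer_split[v Azv Bzv]|_ ->//].
  (* For distinct zeros, <z - z0, v - u> is positive by uniform monotonicity of [A], but at most 0
     by monotonicity of [B] at the opposite values. *)
  apply/eqP; rewrite -subr_eq0 -normr_le0 leNgt; apply/negP => zz0.
  have [d d0 /(_ _ _ _ _ Azv Azu (lexx _))] := uniformly_monotone_gap umA zz0.
  have := monotone_opP (proj1 maxB) Bzv Bzu.
  by rewrite -opprD innerNr; lra.
split; first by exists xbar.
exists xbar; split=> //; split.
  (* By [dist_le], each [n] with [y n] at distance at least [eps] from [z0] costs at least [2 * d]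
     in squared distance to [xbar]. *)
  rewrite ax; apply: (cvg_decrements0 (u := fun n => `|x n - xbar| ^+ 2)) => //.
  move=> eps /(uniformly_monotone_gap umA)[d d0 Hd]; exists d => // n.
  rewrite distrC => le_eps; have Ay : A (y n) (x n - y n).
    by rewrite yE; exact: resolventP.
  by have := Hd _ _ _ _ Ay Azu le_eps; have := dist_le n; lra.
move=> [C [invC umC]].
have decT : decreases_sq_dist T.
  case: invC umC => ->.
  - exact: dr_decreases_sq_dist_invA maxA maxB TE umA.
  - exact: dr_decreases_sq_dist_invB maxA maxB TE umA.
split.
  split; first exact: decreases_sq_dist_contraction.
  apply/seteqP; split=> [z Tz|_ ->//].
  (* Two distinct fixed points would have to get strictly closer under [T]. *)
  apply/eqP; rewrite -subr_eq0 -normr_le0 leNgt; apply/negP => zx.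
  have [d d0 /(_ _ _ (lexx _))] := decT _ zx.
  by rewrite Tz Tx; lra.
apply: (cvg_decrements0 (u := fun n => `|x n - xbar| ^+ 2)) => //.
move=> eps /decT[d d0 Hd]; exists d => // n.
by rewrite distrC => /Hd; rewrite Tx -xES; lra.
Qed.
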